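(* Suppose that the kernel $k$ is of the form $$k(j)=\frac{c}{|j|^{3}\,[1+\log(|j|)]^{1+\alpha}},\quad j\in\mathbb{Z}\setminus\{0\},\qquad k(0)=0,$$ with $c,\alpha>0$. Then the corresponding operator $\mathcal{L}$ satisfies the $CD(0,d)$-inequality for some finite $d>0$.
   Context: A kernel is a function $k:\mathbb{Z}\to[0,\infty)$ with $k(0)=0$, $k(-j)=k(j)$ for all $j\in\mathbb{N}$, and $0<|k|_1:=\sum_{j\in\mathbb{Z}}k(j)<\infty$. The associated operator is $\mathcal{L}u(x)=\sum_{j\in\mathbb{Z}}k(j)\big(u(x+j)-u(x)\big)$, $x\in\mathbb{Z}$, and the iterated carré du champ operator is given by $\Gamma_2(u)(x)=\frac14\sum_{j,l\in\mathbb{Z}}k(j)k(l)\big(u(x+j+l)-u(x+j)-u(x+l)+u(x)\big)^2\in[0,\infty]$. A function $u:\mathbb{Z}\to\mathbb{R}$ is admissible for $CD(0,d)$ at $x\in\mathbb{Z}$ if $\sum_{j\in\mathbb{Z}}k(j)|u(x+j)|<\infty$. For $d\in(0,\infty)$, $\mathcal{L}$ satisfies $CD(0,d)$ if $\Gamma_2(u)(x)\ge\frac1d\big(\mathcal{L}u(x)\big)^2$ for every $x\in\mathbb{Z}$ and every $u$ admissible at $x$. *)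

(* Defs.v *)
From mathcomp Require Import all_boot all_order all_algebra.
From mathcomp Require Import classical_sets reals constructive_ereal.
From mathcomp Require Import ereal numfun esum exp.

Set Implicit Arguments.
Unset Strict Implicit.
Unset Printing Implicit Defensive.

Import Order.TTheory GRing.Theory Num.Theory.

Local Open Scope classical_set_scope.
Local Open Scope ring_scope.

(* \esum is a supremum of finite sums, hence meaningful for nonnegative terms
   only; a signed series over Z is summed as the difference of the sums of its
   positive and negative parts.  This is the usual sum as soon as the series
   converges absolutely, and the junk value 0 otherwise. *)
Definition sumZ (R : realType) (f : int -> R) : R :=
  fine (\esum_(j in [set: int]) (EFin \o f)^\+%E j
        - \esum_(j in [set: int]) (EFin \o f)^\-%E j)%E.

Definition l1norm (R : realType) (k : int -> R) : \bar R :=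
  \esum_(j in [set: int]) (k j)%:E.

Definition is_kernel (R : realType) (k : int -> R) : Prop :=
  [/\ forall j : int, 0 <= k j,
      k 0 = 0,
      forall j : nat, k (- j%:Z) = k j%:Z
    & (0 < l1norm k < +oo)%E].

Definition generator (R : realType) (k : int -> R) (u : int -> R) (x : int) : R :=
  sumZ (fun j => k j * (u (x + j) - u x)).

Definition Gamma2 (R : realType) (k : int -> R) (u : int -> R) (x : int) : \bar R :=
  ((4^-1)%:E * \esum_(p in [set: int * int])
     (k p.1 * k p.2 *
      (u (x + p.1 + p.2) - u (x + p.1) - u (x + p.2) + u x) ^+ 2)%:E)%E.

Definition admissible (R : realType) (k : int -> R) (u : int -> R) (x : int) : Prop :=
  (\esum_(j in [set: int]) (k j * `|u (x + j)|)%:E < +oo)%E.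

(* The curvature-dimension inequality CD(0,d); meant for 0 < d. *)
Definition CD0 (R : realType) (k : int -> R) (d : R) : Prop :=
  forall (x : int) (u : int -> R), admissible k u x ->
    ((d^-1 * (generator k u x) ^+ 2)%:E <= Gamma2 k u x)%E.

(* Main.v *)
Require Import Defs.
From mathcomp Require Import all_boot all_order all_algebra.
From mathcomp Require Import classical_sets cardinality fsbigop.
From mathcomp Require Import reals constructive_ereal.
From mathcomp Require Import ereal numfun esum sequences exp.
From mathcomp Require Import ring lra zify.

Import Order.TTheory GRing.Theory Num.Theory.

Local Open Scope ring_scope.

(** Write [D(i, j) = u(x+i+j) - u(x+i) - u(x+j) + u(x)], so that [4 Gamma2(u)(x)]
    is the sum of [k(i) k(j) D(i, j)^2], and [g(n) = u(x+n) + u(x-n) - 2 u(x)], so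
    that [Lu(x)] is the sum of [k(n) g(n)] over [n >= 1].

    The antidiagonal terms [D(n, -n) = - g(n)] alone do not control [Lu(x)], since
    they carry the weight [k(n)^2], which is much smaller than [k(n)].  Instead,
    [g(n)] is reached from [g(1)] by unit steps ([sym_diff_telescope]):
      [g(n) = n g(1) + sum_(1 <= i < n) (D(i, 1) + D(-i, -1))],
    and the corrections occur in [Gamma2] with weight [k(1) k(i)], of first order in
    the kernel.  Exchanging the two summations, the increment at [i] enters [Lu(x)]
    with the weight [sum_(n > i) k(n)].  If this tail is at most [C i k(i)], then
    Cauchy-Schwarz with respect to the weight [k] gives
      [Lu(x)^2 <= 2 (M g(1))^2 + 2 C^2 M sum_i k(i) (D(i, 1) + D(-i, -1))^2],
    where [M] bounds the sum of [n^2 k(n)] over [n >= 1]; both terms are multiples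
    of [Gamma2(u)(x)].  This is [CD0_of_tail_moment]: a symmetric kernel with
    [k(1) > 0], finite second moment and tails comparable to [i k(i)] satisfies
    CD(0,d) for some finite [d].

    For the logarithmic kernel, [n^3 k(n)] is nonincreasing, which gives the tail
    condition with [C = 1].  The second moment is [c] times the series of
    [1 / (n (1 + log n)^(1 + alpha))], which is dominated by a telescoping series in
    [(1 + log n)^(- alpha)] ([sum_inv_log_le]); without the logarithmic factor, the
    second moment of [1 / |j|^3] would diverge. *)

(** * Signed and nonnegative sums over the integers *)

Lemma sum_le_esum (R : realType) (T : choiceType) (a : T -> \bar R) (s : seq T) :
  uniq s -> (\sum_(t <- s) a t <= \esum_(t in [set: T]) a t)%E.
Proof.
move=> s_uniq; apply: esum_ge; exists [set` s]%classic; last by rewrite fsbig_seq.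
by split; first exact: finite_seq.
Qed.

(** The finite exhaustion [-N < j < N] of the integers, listed so that sums over it
    split into pairs [n], [-n]. *)
Definition intball (N : nat) : seq int :=
  0 :: [seq i%:Z | i <- index_iota 1 N] ++ [seq - i%:Z | i <- index_iota 1 N].

Lemma mem_intball (N : nat) (j : int) : (`|j| < N)%N -> j \in intball N.
Proof.
rewrite inE mem_cat => jN; have [//|j0 /=] := eqVneq j 0.
apply/orP; case: (leP 0 j) => j_sgn; [left|right]; apply/mapP;
  exists `|j|%N; rewrite ?mem_index_iota //; lia.
Qed.

Lemma intball_uniq (N : nat) : uniq (intball N).
Proof.
rewrite cons_uniq cat_uniq !map_inj_uniq ?iota_uniq /=; last 2 first.
- by move=> i i' /oppr_inj[].
- by move=> i i' [].
rewrite andbT mem_cat negb_or -andbA; apply/and3P; split.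
- by apply/mapP => -[i]; rewrite mem_index_iota; lia.
- by apply/mapP => -[i]; rewrite mem_index_iota; lia.
apply/hasPn => j /mapP[i]; rewrite mem_index_iota => i_gt0 ->.
by apply/negP => /mapP[i']; rewrite mem_index_iota; lia.
Qed.

Lemma big_intball (R : zmodType) (a : int -> R) (N : nat) :
  \sum_(j <- intball N) a j = a 0 + \sum_(1 <= n < N) (a n%:Z + a (- n%:Z)).
Proof. by rewrite big_cons [in RHS]big_split big_cat !big_map. Qed.

Lemma esum_int_le (R : realType) (a : int -> R) (B : \bar R) :
  (forall j, 0 <= a j) ->
  (forall N, ((\sum_(j <- intball N) a j)%:E <= B)%E) ->
  (\esum_(j in [set: int]) (a j)%:E <= B)%E.
Proof.
move=> a_ge0 aB; apply: ge_ereal_sup => _ [A [finA _] <-].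
have [N AN] : exists N, forall j, A j -> (`|j| < N)%N.
  have /finite_seqP[s As] := finA.
  exists (\max_(j <- s) `|j|%N).+1 => j; rewrite As /= => js.
  by rewrite ltnS; exact: (@leq_bigmax_seq _ s predT (fun j : int => `|j|%N) j).
apply: le_trans (aB N); rewrite -sumEFin [leRHS]fsbig_seq ?intball_uniq//.
apply: lee_fsum_nneg_subset => //.
- by move=> j; rewrite !inE => Aj; apply: mem_intball; exact: AN.
- by move=> j _; rewrite lee_fin.
Qed.

(** Bounds on symmetric partial sums pass to the signed sum.  If the partial sums of
    [f^+] and [f^-] differ by at most [T], then so do their suprema [P] and [Q],
    first as [P <= Q + T] and [Q <= P + T] in the extended reals.  When [P] or [Q]
    is infinite, [sumZ] takes the value 0, which satisfies the bound. *)
Lemma abs_sumZ_le (R : realType) (f : int -> R) (T : R) :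
  f 0 = 0 ->
  (forall N, `|\sum_(1 <= n < N) (f n%:Z + f (- n%:Z))| <= T) ->
  `|sumZ f| <= T.
Proof.
move=> f0 fT; have T0 : 0 <= T by rewrite (le_trans _ (fT 0%N)).
rewrite /sumZ.
have posE j : (EFin \o f)^\+%E j = (Num.max (f j) 0)%:E.
  by rewrite funeposE EFin_max.
have negE j : (EFin \o f)^\-%E j = (Num.max (- f j) 0)%:E.
  by rewrite funenegE EFin_max.
under eq_esum do rewrite posE; under [X in (_ - X)%E]eq_esum do rewrite negE.
set P := (\esum_(j in _) _)%E; set Q := (\esum_(j in _) _)%E.
have max0 (y : R) : 0 <= Num.max y 0 by rewrite le_max lexx orbT.
have diffE N : \sum_(j <- intball N) Num.max (f j) 0 -
    \sum_(j <- intball N) Num.max (- f j) 0 =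
    \sum_(1 <= n < N) (f n%:Z + f (- n%:Z)).
  transitivity (\sum_(j <- intball N) f j); last by rewrite big_intball f0 add0r.
  rewrite -sumrB; apply: eq_bigr => j _.
  by rewrite /Num.max; case: ifP; case: ifP; lra.
have half (a b : int -> R) : (forall j, 0 <= a j) ->
    (forall N, \sum_(j <- intball N) a j - \sum_(j <- intball N) b j <= T) ->
    (\esum_(j in [set: int]) (a j)%:E <=
     \esum_(j in [set: int]) (b j)%:E + T%:E)%E.
  move=> a_ge0 abT; apply: esum_int_le => // N.
  apply: (@le_trans _ _ ((\sum_(j <- intball N) b j)%:E + T%:E)%E).
    by rewrite lee_fin -lerBlDl.
  by rewrite leeD2r// -sumEFin sum_le_esum ?intball_uniq.
have PQ : (P <= Q + T%:E)%E.
  apply: half => [//|N].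
  by rewrite diffE; apply: le_trans (fT N); rewrite ler_norm.
have QP : (Q <= P + T%:E)%E.
  apply: half => [//|N].
  by rewrite -opprB diffE; apply: le_trans (fT N); rewrite -normrN ler_norm.
have P0 : (0 <= P)%E by apply: esum_ge0 => j _; rewrite lee_fin.
have Q0 : (0 <= Q)%E by apply: esum_ge0 => j _; rewrite lee_fin.
move: P Q PQ QP P0 Q0 => [p| |] [q| |] //=; rewrite ?normr0//.
by rewrite -!EFinD !lee_fin => pq qp _ _; rewrite ler_norml; lra.
Qed.

(** * Summation by parts and Cauchy-Schwarz *)

Lemma Cauchy_Schwarz_sum (R : realDomainType) (I : Type) (s : seq I)
    (w a b : I -> R) : (forall i, 0 <= w i) ->
  (\sum_(i <- s) w i * a i * b i) ^+ 2 <=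
  (\sum_(i <- s) w i * a i ^+ 2) * (\sum_(i <- s) w i * b i ^+ 2).
Proof.
move=> w0; elim: s => [|i s]; first by rewrite !big_nil expr0n mul0r.
rewrite !big_cons.
set S := \sum_(_ <- _) _; set A := \sum_(_ <- _) _; set B := \sum_(_ <- _) _.
have A0 : 0 <= A by apply: sumr_ge0 => j _; rewrite mulr_ge0 ?sqr_ge0.
have B0 : 0 <= B by apply: sumr_ge0 => j _; rewrite mulr_ge0 ?sqr_ge0.
move=> SAB.
(* The geometric mean of the two terms on the right bounds the cross term. *)
have cross : 2 * (S * (a i * b i)) <= A * b i ^+ 2 + B * a i ^+ 2.
  have AB0 : 0 <= A * b i ^+ 2 + B * a i ^+ 2.
    by rewrite addr_ge0// mulr_ge0 ?sqr_ge0.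
  apply: le_trans (ler_norm _) _.
  rewrite -(ler_pXn2r (n := 2)) ?nnegrE// real_normK ?num_real//.
  apply: (@le_trans _ _ (4 * (A * B) * (a i * b i) ^+ 2)).
    have := ler_wpM2r (sqr_ge0 (a i * b i)) SAB; nra.
  have := sqr_ge0 (A * b i ^+ 2 - B * a i ^+ 2); nra.
have := ler_wpM2l (w0 i) cross; nra.
Qed.

(** The increment [b i] contributes to every [g n] with [n > i], so after exchanging
    the order of summation it is weighted by a tail of [w], which the tail condition
    makes comparable to [i * w i]. *)
Lemma weighted_sum_parts_le {R : realDomainType} (w g b : nat -> R) (C G : R)
    (N : nat) :
  (forall n, 0 <= w n) -> (forall n, 0 <= b n) ->
  (forall i N', (0 < i)%N ->
    \sum_(i.+1 <= n < N') w n <= C * (i%:R * w i)) ->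
  (forall n, `|g n| <= n%:R * G + \sum_(1 <= i < n) b i) ->
  `|\sum_(1 <= n < N) w n * g n| <=
    G * (\sum_(1 <= n < N) n%:R * w n) +
    C * \sum_(1 <= i < N) w i * i%:R * b i.
Proof.
move=> w0 b0 tail gb; apply: le_trans (ler_norm_sum _ _ _) _.
apply: (@le_trans _ _ (\sum_(1 <= n < N)
    (G * (n%:R * w n) + \sum_(1 <= i < n) w n * b i))).
  apply: ler_sum => n _; rewrite normrM ger0_norm// -mulr_sumr.
  by have := ler_wpM2l (w0 n) (gb n); rewrite mulrDr; lra.
rewrite big_split /= -mulr_sumr lerD2l.
have -> : \sum_(1 <= n < N) \sum_(1 <= i < n) w n * b i =
    \sum_(1 <= i < N) \sum_(i.+1 <= n < N) w n * b i.
  rewrite (eq_big_nat _ _ (F2 := fun n =>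
    \sum_(1 <= i < N | (i < n)%N) w n * b i)); last first.
    by move=> n /andP[_ nN]; rewrite (big_nat_widen _ _ N) ?(ltnW nN).
  rewrite (exchange_big_dep_nat xpredT)//=; apply: eq_big_nat => i /andP[i0 iN].
  by rewrite [RHS](big_nat_widenl _ 1).
rewrite mulr_sumr !big_nat; apply: ler_sum => i /andP[i0 _].
rewrite -mulr_suml; have := ler_wpM2r (b0 i) (tail i N i0); lra.
Qed.

(** * Curvature-dimension inequality from tails and second moment *)

Definition mixed_diff {R : zmodType} (u : int -> R) (x i j : int) : R :=
  u (x + i + j) - u (x + i) - u (x + j) + u x.

Definition sym_diff {R : zmodType} (u : int -> R) (x j : int) : R :=
  (u (x + j) - u x) + (u (x - j) - u x).

(** A unit step changes the symmetric difference by its value at 1, up to mixed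
    differences in which one increment is 1 or -1. *)
Lemma sym_diff_telescope (R : comNzRingType) (u : int -> R) (x : int) (n : nat) :
  sym_diff u x n%:Z = n%:R * sym_diff u x 1 +
    \sum_(1 <= i < n) (mixed_diff u x i%:Z 1 + mixed_diff u x (- i%:Z) (-1)).
Proof.
elim: n => [|[|n] IH].
- by rewrite big_geq// /sym_diff subr0 !addr0 subrr mul0r addr0.
- by rewrite big_geq// mul1r addr0.
rewrite big_nat_recr//= addrA (_ : n.+2%:R = n.+1%:R + 1); last by rewrite -natr1.
have step : sym_diff u x n.+2 = sym_diff u x n.+1 + sym_diff u x 1 +
    (mixed_diff u x n.+1 1 + mixed_diff u x (- n.+1%:Z) (-1)).
  rewrite /sym_diff /mixed_diff.
  have -> : x + n.+1 + 1 = x + n.+2 by lia.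
  have -> : x - n.+1%:Z - 1 = x - n.+2%:Z by lia.
  ring.
by rewrite step IH; ring.
Qed.

Lemma Gamma2_ge {R : realType} (k u : int -> R) (x : int) (s : seq (int * int)) :
  uniq s ->
  ((4^-1 * \sum_(p <- s) k p.1 * k p.2 * mixed_diff u x p.1 p.2 ^+ 2)%:E
    <= Gamma2 k u x)%E.
Proof.
move=> s_uniq; rewrite EFinM -sumEFin lee_wpmul2l ?lee_fin ?invr_ge0//.
exact: (sum_le_esum _ _
  (fun p => (k p.1 * k p.2 * mixed_diff u x p.1 p.2 ^+ 2)%:E)).
Qed.

(** Only three families of pairs are kept in [Gamma2]: [(1, -1)], which controls the
    first symmetric difference, and the pairs [(i, 1)], [(-i, -1)], which control the
    increments of the telescoping formula. *)
Lemma CD0_of_tail_moment {R : realType} (k : int -> R) (C M : R) :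
  is_kernel k -> 0 < k 1 ->
  (forall i N, (0 < i)%N ->
    \sum_(i.+1 <= n < N) k n%:Z <= C * (i%:R * k i%:Z)) ->
  (forall N, \sum_(1 <= n < N) n%:R ^+ 2 * k n%:Z <= M) ->
  exists d : R, 0 < d /\ CD0 k d.
Proof.
move=> [k_ge0 k0 kN _] k1 tail moment.
have M0 : 0 < M.
  by apply: lt_le_trans (moment 2%N); rewrite big_nat1 expr1n mul1r.
(* The two terms come from the first symmetric difference and from the
   increments. *)
pose d := 8 * M ^+ 2 / k 1 ^+ 2 + 16 * C ^+ 2 * M / k 1.
have d0 : 0 < d.
  apply: ltr_wpDr; last by rewrite divr_gt0 ?mulr_gt0 ?exprn_gt0.
  by rewrite divr_ge0 ?(ltW k1)// mulr_ge0 ?(ltW M0)// mulr_ge0 ?sqr_ge0.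
exists d; split=> // x u _.
have := Gamma2_ge k u x [::] isT; rewrite big_nil mulr0.
case E : (Gamma2 k u x) => [g| |]; [rewrite lee_fin => g0| by rewrite !leey|by []].
have Gamma_ge s : uniq s ->
    \sum_(p <- s) k p.1 * k p.2 * mixed_diff u x p.1 p.2 ^+ 2 <= 4 * g.
  by move=> /(Gamma2_ge k u x); rewrite E lee_fin; lra.
pose G := `|sym_diff u x 1|.
pose b (i : nat) :=
  `|mixed_diff u x i%:Z 1 + mixed_diff u x (- i%:Z) (-1)|.
have kN1 : k (-1) = k 1 by exact: (kN 1%N).
have G_le : k 1 ^+ 2 * G ^+ 2 <= 4 * g.
  have := Gamma_ge [:: (1, -1)] isT.
  rewrite big_seq1 /= kN1 /G real_normK ?num_real//.
  by rewrite /mixed_diff /sym_diff addrK; lra.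
have b_le N : k 1 * (\sum_(1 <= i < N) k i%:Z * b i ^+ 2) <= 8 * g.
  pose s : seq (int * int) := [seq (i%:Z, 1) | i <- index_iota 1 N] ++
                              [seq (- i%:Z, -1) | i <- index_iota 1 N].
  have /Gamma_ge : uniq s.
    rewrite cat_uniq !map_inj_uniq ?iota_uniq /=; last 2 first.
    - by move=> i j [] /oppr_inj [].
    - by move=> i j [].
    by rewrite andbT; apply/hasPn => _ /mapP[i _ ->]; apply/mapP => -[j _ []].
  rewrite big_cat !big_map /= => sum_le.
  rewrite (_ : 8 * g = 2 * (4 * g)); last by ring.
  apply: le_trans (ler_wpM2l _ sum_le) => //.
  rewrite -(@big_split R 0 +%R) !mulr_sumr; apply: ler_sum => i _.
  rewrite kN1 kN /b real_normK ?num_real//.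
  set D := mixed_diff _ _ _ _; set D' := mixed_diff _ _ _ _.
  rewrite -subr_ge0.
  have -> : 2 * (k i * k 1 * D ^+ 2 + k i * k 1 * D' ^+ 2) -
      k 1 * (k i * (D + D') ^+ 2) = k i * k 1 * (D - D') ^+ 2 by ring.
  by rewrite mulr_ge0 ?sqr_ge0// mulr_ge0 ?(ltW k1).
suff gen_le : `|generator k u x| <= Num.sqrt (d * g).
  have dg0 : 0 <= d * g by rewrite mulr_ge0 ?(ltW d0).
  rewrite lee_fin ler_pdivrMl// -(sqr_sqrtr dg0) -real_normK ?num_real//.
  by rewrite ler_pXn2r ?nnegrE ?sqrtr_ge0.
apply: abs_sumZ_le => [|N]; first by rewrite k0 mul0r.
rewrite (eq_bigr (fun n : nat => k n%:Z * sym_diff u x n%:Z)); last first.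
  by move=> n _; rewrite kN -mulrDr.
set X := \sum_(1 <= n < N) _.
pose S1 := \sum_(1 <= n < N) n%:R * k n%:Z.
pose S2 := \sum_(1 <= i < N) k i%:Z * i%:R * b i.
have X_le : `|X| <= G * S1 + C * S2.
  apply: weighted_sum_parts_le => [//|n|//|n]; first exact: normr_ge0.
  rewrite sym_diff_telescope; apply: le_trans (ler_normD _ _) _.
  by rewrite normrM normr_nat lerD2l ler_norm_sum.
have S1_le : S1 <= M.
  apply: le_trans (moment N); rewrite /S1 !big_nat; apply: ler_sum => n /andP[n1 _].
  by rewrite ler_wpM2r// ler_eXnr// ler1n.
have S1_ge0 : 0 <= S1 by apply: sumr_ge0 => n _; rewrite mulr_ge0.
have S2_le : k 1 * S2 ^+ 2 <= 8 * M * g.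
  pose A := \sum_(1 <= i < N) k i%:Z * i%:R ^+ 2.
  pose B := \sum_(1 <= i < N) k i%:Z * b i ^+ 2.
  have A_le : A <= M.
    by rewrite (le_trans _ (moment N))// ler_sum// => i _; rewrite mulrC.
  have A_ge0 : 0 <= A by apply: sumr_ge0 => i _; rewrite mulr_ge0 ?sqr_ge0.
  apply: (@le_trans _ _ (k 1 * (A * B))).
    by rewrite ler_wpM2l ?(ltW k1)// Cauchy_Schwarz_sum.
  have := ler_wpM2l A_ge0 (b_le N); rewrite -/B.
  have : 0 <= 8 * g by rewrite mulr_ge0.
  by move=> /(ler_wpM2r)/(_ _ _ A_le); lra.
rewrite -sqrtr_sqr ler_wsqrtr//.
apply: (@le_trans _ _ ((G * S1 + C * S2) ^+ 2)).
  by rewrite -real_normK ?num_real// lerXn2r ?nnegrE ?(le_trans _ X_le).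
apply: (@le_trans _ _ (2 * (M ^+ 2 * G ^+ 2) + 2 * (C ^+ 2 * S2 ^+ 2))).
  have : G ^+ 2 * S1 ^+ 2 <= G ^+ 2 * M ^+ 2.
    by rewrite ler_wpM2l ?sqr_ge0// lerXn2r ?nnegrE ?(ltW M0).
  have := sqr_ge0 (G * S1 - C * S2); lra.
have -> : d * g = 2 * (M ^+ 2 * (4 * g / k 1 ^+ 2)) +
                  2 * (C ^+ 2 * (8 * M * g / k 1)).
  by rewrite /d; field; rewrite gt_eqF.
rewrite lerD// ler_wpM2l// ler_wpM2l ?sqr_ge0// ler_pdivlMr ?exprn_gt0//.
  by rewrite mulrC.
by rewrite mulrC.
Qed.

(** * The logarithmic kernel *)

(** Since [i < n], [1/n^3] is at most [(1/i) (1/(n-1) - 1/n)], which telescopes. *)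
Lemma sum_inv_cube_le {R : realFieldType} (i N : nat) : (0 < i)%N ->
  \sum_(i.+1 <= n < N) (n%:R ^+ 3)^-1 <= (i%:R ^+ 2)^-1 :> R.
Proof.
move=> i0; have [Ni|iN] := leqP N i.+1.
  by rewrite big_geq// invr_ge0 exprn_ge0.
have i0R : 0 < i%:R :> R by rewrite ltr0n.
apply: (@le_trans _ _ (\sum_(i.+1 <= n < N) i%:R^-1 * (n.-1%:R^-1 - n%:R^-1))).
  rewrite !big_nat; apply: ler_sum => -[//|n] /andP[].
  rewrite ltnS => i_n _ /=.
  have n0 : 0 < n%:R :> R by rewrite ltr0n (leq_trans i0).
  have inR : i%:R <= n%:R :> R by rewrite ler_nat.
  have -> : i%:R^-1 * (n%:R^-1 - n.+1%:R^-1) = (i%:R * (n%:R * n.+1%:R))^-1 :> R.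
    by rewrite -natr1; field; rewrite !gt_eqF// addr_gt0.
  rewrite lef_pV2 ?posrE ?exprn_gt0 ?mulr_gt0 ?ltr0Sn//.
  rewrite exprS expr2 ler_pM ?mulr_ge0 ?ler0n ?ler_wpM2r ?ler0n ?ler_nat//.
  by rewrite ltnW.
rewrite -mulr_sumr big_add1.
rewrite (@telescope_sumr_eq _ _ _ (fun n => - n%:R^-1)); last 2 first.
- by lia.
- by move=> n _; rewrite opprK addrC.
rewrite opprK expr2 invfM ler_wpM2l ?invr_ge0// gerDr.
by rewrite oppr_le0 invr_ge0.
Qed.

(** Beyond [i] such a weight decays at least like [n^-3], whose tail is of order
    [i^-2]. *)
Lemma tail_le_of_cube_nonincreasing {R : realFieldType} (w : nat -> R) (i N : nat) :
  (0 < i)%N -> 0 <= w i ->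
  (forall n, (i <= n)%N -> n%:R ^+ 3 * w n <= i%:R ^+ 3 * w i) ->
  \sum_(i.+1 <= n < N) w n <= i%:R * w i.
Proof.
move=> i0 wi0 w_cube.
have i0R : 0 < i%:R :> R by rewrite ltr0n.
apply: (@le_trans _ _ (\sum_(i.+1 <= n < N) i%:R ^+ 3 * w i * (n%:R ^+ 3)^-1)).
  rewrite !big_nat; apply: ler_sum => n /andP[i_n _].
  rewrite ler_pdivlMr; first by rewrite mulrC w_cube// ltnW.
  by rewrite exprn_gt0// ltr0n (leq_trans _ i_n).
rewrite -mulr_sumr.
apply: le_trans (ler_wpM2l _ (sum_inv_cube_le _ _ i0)) _.
  by rewrite mulr_ge0// exprn_ge0.
rewrite le_eqVlt; apply/orP; left; apply/eqP; field.
by rewrite gt_eqF.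
Qed.

(** A discrete form of [d(- t^(-a)) = a t^(-1-a) dt], with sharp constant [a].  After
    division by [t^(-a)] it reads [(t/s)^a - 1 >= a (1 - s/t)], which follows from
    [exp y >= 1 + y] and [ln y <= y - 1]. *)
Lemma powRN_diff_ge {R : realType} (a s t : R) : 0 < a -> 0 < s -> 0 < t ->
  a * (t - s) / t `^ (1 + a) <= s `^ (- a) - t `^ (- a).
Proof.
move=> a0 s0 t0.
have ta0 : 0 < t `^ (- a) by rewrite powR_gt0.
have -> : a * (t - s) / t `^ (1 + a) = t `^ (- a) * (a * (1 - s / t)).
  rewrite powRN powRD ?(gt_eqF t0) ?implybT// powRr1 ?(ltW t0)//; field.
  by rewrite !gt_eqF// powR_gt0.
have -> : s `^ (- a) = t `^ (- a) * expR (- a * ln (s / t)).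
  rewrite /powR !gt_eqF// -expRD; congr expR.
  by rewrite ln_div ?posrE//; ring.
rewrite -[X in _ <= _ - X]mulr1 -mulrBr ler_wpM2l ?(ltW ta0)//.
have := expR_ge1Dx (- a * ln (s / t)).
have := le_ln1Dx (x := s / t - 1); rewrite ltrBrDl subrr divr_gt0// => /(_ isT).
rewrite addrC subrK => /(ler_wpM2l (ltW a0)); lra.
Qed.

Lemma ln_succ_ge {R : realType} (n : nat) : (0 < n)%N ->
  n.+1%:R^-1 <= ln n.+1%:R - ln n%:R :> R.
Proof.
move=> n0; have n0R : 0 < n%:R :> R by rewrite ltr0n.
rewrite -opprB -ln_div ?posrE ?ltr0Sn//.
have -> : n%:R / n.+1%:R = 1 + - n.+1%:R^-1 :> R.
  by rewrite -natr1; field; rewrite gt_eqF// addr_gt0.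
rewrite lerNr le_ln1Dx// ltrN2 invf_lt1 ?ltr0Sn//.
by rewrite ltr1n.
Qed.

(** The substitution [t = 1 + log n] of the integral test: by [powRN_diff_ge] and
    [ln_succ_ge], each term with [n >= 2] is at most the increment of
    [- (1 + log n)^(-a) / a]. *)
Lemma sum_inv_log_le {R : realType} (a : R) (N : nat) : 0 < a ->
  \sum_(1 <= n < N) (n%:R * (1 + ln n%:R) `^ (1 + a))^-1 <= 1 + a^-1.
Proof.
move=> a0; have [N1|N1] := leqP N 1.
  by rewrite big_geq// addr_ge0 ?invr_ge0 ?(ltW a0).
rewrite big_ltn// ln1 addr0 powR1 mulr1 invr1 lerD2l.
rewrite -[leRHS]mulr1 ler_pdivlMl// mulr_sumr.
pose phi n : R := (1 + ln n%:R) `^ (- a).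
apply: (@le_trans _ _ (\sum_(2 <= n < N) (phi n.-1 - phi n))).
  rewrite !big_nat; apply: ler_sum => -[//|n] /andP[n0 _] /=.
  have ln_n : 0 <= ln n%:R :> R by rewrite ln_ge0// ler1n.
  have ln_step := @ln_succ_ge R _ n0.
  have step_ge0 : 0 <= n.+1%:R^-1 :> R by rewrite invr_ge0.
  have ln_n1 : ln n%:R <= ln n.+1%:R :> R.
    by rewrite -subr_ge0 (le_trans step_ge0).
  apply: le_trans (powRN_diff_ge _ _ _ a0 _ _); last 2 first.
  - by rewrite ltr_wpDr.
  - by rewrite ltr_wpDr// (le_trans ln_n).
  rewrite invfM mulrA ler_wpM2r ?invr_ge0 ?powR_ge0//.
  by rewrite ler_wpM2l ?(ltW a0)// opprD addrACA subrr add0r.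
rewrite big_add1 (@telescope_sumr_eq _ _ _ (fun n => - phi n)); last 2 first.
- by lia.
- by move=> n _; rewrite opprK addrC.
rewrite opprK {2}/phi ln1 addr0 powR1 gerDr oppr_le0.
exact: powR_ge0.
Qed.

Theorem corollary4p2 (R : realType) (c alpha : R) (k : int -> R)
  (c_gt0 : 0 < c) (alpha_gt0 : 0 < alpha)
  (k_kernel : is_kernel k)
  (k_form : forall j : int, j != 0 ->
     k j = c / (`|j|%:~R ^+ 3 * (1 + ln (`|j|%:~R : R)) `^ (1 + alpha)))
  (k_0 : k 0 = 0) :
  exists d : R, 0 < d /\ CD0 k d.
Proof.
pose L (n : nat) : R := (1 + ln n%:R) `^ (1 + alpha).
have kE (n : nat) : (0 < n)%N -> k n%:Z = c / (n%:R ^+ 3 * L n).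
  by move=> n0; rewrite k_form// -lt0n.
have L_gt0 (n : nat) : (0 < n)%N -> 0 < L n.
  by move=> n0; rewrite powR_gt0// ltr_wpDr// ln_ge0// ler1n.
have nR_gt0 (n : nat) : (0 < n)%N -> 0 < n%:R :> R by rewrite ltr0n.
have [k_ge0 _ _ _] := k_kernel.
apply: (CD0_of_tail_moment k 1 (c * (1 + alpha^-1))) => //.
- by rewrite (kE 1%N)// divr_gt0// mulr_gt0// L_gt0.
- move=> i N i0; rewrite mul1r tail_le_of_cube_nonincreasing// => n i_n.
  have n0 : (0 < n)%N := leq_trans i0 i_n.
  have cubeE m : (0 < m)%N -> m%:R ^+ 3 * k m%:Z = c / L m.
    move=> m0; rewrite kE//; field.
    by rewrite !gt_eqF ?L_gt0 ?nR_gt0.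
  rewrite !cubeE// ler_wpM2l ?(ltW c_gt0)// lef_pV2 ?posrE ?L_gt0//.
  rewrite /L ge0_ler_powR ?nnegrE ?addr_ge0 ?ln_ge0 ?ler1n ?(ltW alpha_gt0)//.
  by rewrite lerD2l ler_ln ?posrE ?nR_gt0// ler_nat.
- move=> N; apply: le_trans (ler_wpM2l (ltW c_gt0) (sum_inv_log_le _ N alpha_gt0)).
  rewrite mulr_sumr !big_nat; apply: ler_sum => n /andP[n0 _].
  rewrite kE// le_eqVlt; apply/orP; left; apply/eqP; rewrite -/(L n); field.
  by rewrite !gt_eqF ?L_gt0 ?nR_gt0.
Qed.
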